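(* For each integer $n\ge1$, $$s_{n-1}(n)=(n-1)^2\,(n-1)!.$$
   Context: $[m]=\{1,2,\dots,m\}$. A matching on $[2n]$ is a partition of $[2n]$ into $n$ two-element subsets, called edges. For a matching $M$ on $[2n]$ and $k\in[2n]$, let $x_k(M)$ be the number of edges of $M$ with one endpoint in $[k]$ and the other in $[2n]\setminus[k]$. The sock number of $M$ is $y(M)=\max_{1\le k\le 2n}x_k(M)$. Let $s_j(n)$ be the number of matchings $M$ on $[2n]$ with $y(M)=j$. *)

(* Defs.v *)
From mathcomp Require Import all_boot.

Set Implicit Arguments.
Unset Strict Implicit.
Unset Printing Implicit Defensive.

(* The ground set [N] = {1, ..., N} is represented by 'I_N, the ordinal i
   standing for the integer i + 1. *)

(* The subset [k] of [N]. *)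
Definition initial (N k : nat) : {set 'I_N} := [set i : 'I_N | i < k].

Definition is_matching (n : nat) (M : {set {set 'I_(2 * n)}}) : bool :=
  [&& partition M [set: 'I_(2 * n)], #|M| == n & [forall e in M, #|e| == 2]].

Definition crossing (n : nat) (M : {set {set 'I_(2 * n)}}) (k : nat) : nat :=
  #|[set e in M | [exists i in e, exists j in e,
                     (i \in initial (2 * n) k) &&
                     (j \in ~: initial (2 * n) k)]]|.

Definition sock_number (n : nat) (M : {set {set 'I_(2 * n)}}) : nat :=
  \max_(1 <= k < (2 * n).+1) crossing M k.

Definition sock_count (j n : nat) : nat :=
  #|[set M : {set {set 'I_(2 * n)}} | is_matching M & sock_number M == j]|.

(* Main.v *)
(* For k in [2n] let i, c, o count the edges of M inside [k], across k, and
   outside [k]. Then 2 i + c = k and i + c + o = n, so c = n - 1 forces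
   k = n - 1 (with i = 0) or k = n + 1 (with o = 0). Since i and o change by at
   most one from k to k + 1, the sock number is n - 1 exactly when M has one
   edge e1 inside [n], one edge e2 inside [2n] \ [n], and e1 contains n or e2
   contains n + 1. There are C(n,2)^2 - C(n-1,2)^2 = (n-1)^3 such pairs
   (e1, e2), and each extends to M in (n-2)! ways, because all other edges join
   [n] to its complement. *)

Require Import Defs.
From mathcomp Require Import all_boot zify.

Set Implicit Arguments.
Unset Strict Implicit.
Unset Printing Implicit Defensive.

(** Double counting of the pairs related by [r]: summed over [A] they number [#|A|], summed over [B]
    they number [#|B| * c]. *)
Lemma card_fibers (T U : finType) (A : {set T}) (B : {set U})
    (r : T -> U -> bool) (c : nat) :
  (forall x, x \in A -> #|[set y in B | r x y]| = 1) ->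
  (forall y, y \in B -> #|[set x in A | r x y]| = c) ->
  #|A| = #|B| * c.
Proof.
move=> rA rB.
have -> : #|A| = \sum_(x in A) \sum_(y in B | r x y) 1.
  rewrite -sum1_card; apply: eq_bigr => x /rA.
  by rewrite sum1dep_card.
rewrite (exchange_big_dep (fun y => y \in B)); last by move=> ? ? _ /andP[].
transitivity (\sum_(y in B) c); last by rewrite sum_nat_const.
apply: eq_bigr => y yB; rewrite -(rB y yB) -sum1dep_card.
by apply: eq_bigl => x; rewrite yB.
Qed.

(** * Partitions with prescribed blocks *)

Section Blocks.

Variable T : finType.
Implicit Types (D L A B e : {set T}) (M : {set {set T}}).

(** Adding the block [e] is inverse to removing it. Since [Q] is an arbitrary predicate on the
    remaining blocks, the lemma can be iterated to prescribe several blocks. *)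
Lemma card_partitions_block D e (Q : pred {set {set T}}) :
  e != set0 -> e \subset D ->
  #|[set M | [&& partition M D, e \in M & Q (M :\ e)]]|
    = #|[set M | partition M (D :\: e) & Q M]|.
Proof.
move=> e0 eD; set A := [set M | partition M (D :\: e) & Q M].
(* A nonempty [e] cannot be a block of a partition of [D :\: e]; this makes [M |-> e |: M] injective
   on [A]. *)
have eA M : M \in A -> e \notin M.
  rewrite inE => /andP[pM _]; apply: contra e0 => /(partitionS pM).
  by rewrite subsetD => /andP[_]; rewrite -setI_eq0 setIid.
rewrite -(@card_in_imset _ _ (fun M => e |: M) A); last first.
  by move=> M N /eA eM /eA eN /(congr1 (fun X => X :\ e)); rewrite !setU1K.
apply: eq_card => M; rewrite inE; apply/idP/imsetP => [/and3P[pM eM qM]|[N AN ->]].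
  by exists (M :\ e); rewrite ?setD1K // inE qM partitionD1.
have eN := eA _ AN; move: AN; rewrite inE => /andP[pN qN].
rewrite setU11 setU1K // qN !andbT.
have -> : D = e :|: (D :\: e) by rewrite -[in LHS](setID D e) (setIidPr eD).
by apply: partitionU1; rewrite // disjoint_sym disjoints_subset setDE subsetIr.
Qed.

Definition inside M A : {set {set T}} := [set e in M | e \subset A].

Definition cut M A : {set {set T}} :=
  [set e in M | ~~ (e \subset A) && ~~ (e \subset ~: A)].

(** This form forces [#|e| = 2], so a partition into straddling blocks is already a matching between
    [L] and its complement. *)
Definition straddles L e : bool := (#|e :&: L| == 1) && (#|e :\: L| == 1).

(** Induction on [m]: a fixed point [x] of [D :&: L] can be paired with any point [y] of [D :\: L],
    and deleting both leaves the same problem one size smaller. *)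
Lemma card_straddling_matchings L D m :
  #|D :&: L| = m -> #|D :\: L| = m ->
  #|[set M | partition M D & [forall e in M, straddles L e]]| = m`!.
Proof.
elim: m D => [|m IH] D cL cR.
  have -> : D = set0 by apply/eqP; rewrite -cards_eq0 -(cardsID L) cL cR.
  rewrite -[RHS](cards1 (@set0 {set T})); apply: eq_card => M.
  rewrite !inE partition_set0; case: eqP => //= ->.
  by apply/forall_inP => e; rewrite inE.
have /card_gt0P[x] : 0 < #|D :&: L| by rewrite cL.
rewrite inE => /andP[xD xL].
rewrite (@card_fibers _ _ _ (D :\: L) (fun M y => [set x; y] \in M) m`!).
- by rewrite cR factS.
- move=> M; rewrite inE => /andP[pM /forall_inP sM].
  have xM : x \in cover M by rewrite (cover_partition pM).
  (* The partner of [x] is the other point of its block. *)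
  have eM := pblock_mem xM; have := sM _ eM; set e := pblock M x in eM *.
  have xe : x \in e by rewrite mem_pblock.
  case/andP=> /cards1P[x' ex] /cards1P[y ey].
  have {x'} ex : e :&: L = [set x].
    have : x \in e :&: L by rewrite inE xe.
    by rewrite ex inE => /eqP ->.
  have eE : e = [set x; y] by rewrite -(setID e L) ex ey.
  have : y \in e :\: L by rewrite ey inE.
  rewrite inE => /andP[yL ye].
  apply/eqP/cards1P; exists y; apply/setP => z; rewrite !inE.
  apply/idP/eqP => [/andP[/andP[zL zD] zM]|->]; last first.
    by rewrite yL -eE eM (subsetP (partitionS pM eM)).
  have ze : z \in e.
    by rewrite /e (def_pblock (partition_trivIset pM) zM) !inE eqxx ?orbT.
  by apply/set1P; rewrite -ey inE zL.
move=> y; rewrite inE => /andP[yL yD].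
pose e := [set x; y].
have eL : e :&: L = [set x].
  apply/setP => z; rewrite !inE; case: eqP => [->//|_] /=.
  by case: eqP => // ->; rewrite (negbTE yL).
have eR : e :\: L = [set y].
  apply/setP => z; rewrite !inE; case: eqP => [->|_] /=.
    by rewrite xL /=; apply/esym/negbTE; apply: contraNneq yL => <-.
  by rewrite andbC; case: eqP => // ->; rewrite yL.
have sD : e \subset D by apply/subsetP => z /set2P[]->.
have e0 : e != set0 by apply/set0Pn; exists x; rewrite !inE eqxx.
rewrite -(IH (D :\: e)).
- rewrite -(card_partitions_block (fun M => [forall e in M, straddles L e])) //.
  apply: eq_card => M; rewrite !inE -/e -andbA; case: (partition M D) => //=.
  rewrite andbC; case eM: (e \in M) => //=.
  apply/forall_inP/forall_inP => sM f; first by case/setD1P=> _ /sM.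
  move=> fM; have [->|fe] := eqVneq f e; first by rewrite /straddles eL eR !cards1.
  by apply: sM; rewrite !inE fe.
- have -> : (D :\: e) :&: L = (D :&: L) :\ x.
    by rewrite -eL; apply/setP => z; rewrite !inE; case: (z \in L); rewrite ?andbF ?andbT.
  by move: cL; rewrite (cardsD1 x) inE xD xL => -[].
- have -> : (D :\: e) :\: L = (D :\: L) :\ y.
    by rewrite -eR; apply/setP => z; rewrite !inE; case: (z \in L); rewrite ?andbF ?andbT.
  by move: cR; rewrite (cardsD1 y) inE yD yL => -[].
Qed.

Lemma straddlesE L e : #|e| = 2 ->
  straddles L e = ~~ (e \subset L) && ~~ (e \subset ~: L).
Proof.
move=> e2; rewrite -setD_eq0 -disjoints_subset -setI_eq0 -!cards_eq0 /straddles.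
have := cardsID L e; rewrite e2.
by case: #|e :&: L| => [|[|[|?]]]; case: #|e :\: L| => [|[|[|?]]].
Qed.

Lemma subset_setCF e A : e != set0 -> e \subset A -> ~~ (e \subset ~: A).
Proof.
move=> e0 eA; apply: contra e0.
by rewrite -disjoints_subset -setI_eq0 (setIidPl eA).
Qed.

(** Every edge other than [e1] and [e2] must straddle [L], and deleting these two leaves [m] points
    on each side. *)
Lemma card_matchings_inside L e1 e2 m :
  #|L| = m.+2 -> #|~: L| = m.+2 ->
  e1 \subset L -> e2 \subset ~: L -> #|e1| = 2 -> #|e2| = 2 ->
  #|[set M | [&& partition M setT, [forall e in M, #|e| == 2],
      inside M L == [set e1] & inside M (~: L) == [set e2]]]| = m`!.
Proof.
move=> cL cR e1L e2L c1 c2.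
have e10 : e1 != set0 by rewrite -card_gt0 c1.
have e20 : e2 != set0 by rewrite -card_gt0 c2.
have e12 : [disjoint e1 & e2].
  by rewrite disjoint_sym disjoints_subset (subset_trans e2L) ?setCS.
have ne : e2 != e1 by apply: contraTneq e12 => ->; rewrite -setI_eq0 setIid.
have e1R : ~~ (e1 \subset ~: L) by apply: subset_setCF.
have e2R : ~~ (e2 \subset L) by rewrite -(setCK L) subset_setCF.
have s2 : e2 \subset setT :\: e1.
  by rewrite setTD -disjoints_subset disjoint_sym.
rewrite -(@card_straddling_matchings L ((setT :\: e1) :\: e2) m); first last.
- have -> : (setT :\: e1) :\: e2 :\: L = ~: L :\: e2.
    apply/setP => z; rewrite !inE andbT; have := subsetP e1L z.
    by case: (z \in e1); case: (z \in L); rewrite ?andbF ?andbT //= => /(_ isT).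
  by rewrite cardsDS // cR c2; lia.
- have -> : ((setT :\: e1) :\: e2) :&: L = L :\: e1.
    apply/setP => z; rewrite !inE andbT.
    have := subsetP e2L z; rewrite inE.
    by case: (z \in e2); case: (z \in L); rewrite ?andbF ?andbT //= => /(_ isT).
  by rewrite cardsDS // cL c1; lia.
(* First [e2] is put back, then [e1]; hence the predicate for [e1] also records that [e2] is a
   block. *)
rewrite -(card_partitions_block (fun M => [forall e in M, straddles L e])) //.
rewrite -(card_partitions_block
  (fun M => (e2 \in M) && [forall e in M :\ e2, straddles L e])) ?subsetT //.
apply: eq_card => M; rewrite !inE ne /=.
case pM: (partition M setT) => //=.
apply/and3P/and3P => [[/forall_inP M2 /eqP i1 /eqP i2]|[m1 m2 /forall_inP sM]].
  have in1 e : e \in M -> e \subset L -> e = e1.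
    by move=> eM eL; apply/set1P; rewrite -i1 inE eM.
  have in2 e : e \in M -> e \subset ~: L -> e = e2.
    by move=> eM eL; apply/set1P; rewrite -i2 inE eM.
  split.
  - by have := set11 e1; rewrite -i1 inE => /andP[].
  - by have := set11 e2; rewrite -i2 inE => /andP[].
  apply/forall_inP => e; rewrite !inE => /and3P[n2 n1 eM].
  rewrite straddlesE; last exact/eqP/M2.
  by apply/andP; split; [apply: contra n1 => /in1-> | apply: contra n2 => /in2->].
have M2 e : e \in M -> #|e| = 2.
  move=> eM; have [->//|n1] := eqVneq e e1; have [->//|n2] := eqVneq e e2.
  have /andP[/eqP h1 /eqP h2] : straddles L e by apply: sM; rewrite !inE n1 n2.
  by rewrite -(cardsID L) h1 h2.
have str e : e \in M -> e != e1 -> e != e2 ->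
    ~~ (e \subset L) /\ ~~ (e \subset ~: L).
  by move=> eM n1 n2; apply/andP; rewrite -straddlesE ?M2 //; apply: sM; rewrite !inE n1 n2.
split; first by apply/forall_inP => e /M2 ->.
- apply/eqP/setP => e; rewrite !inE; have [->|n1] := eqVneq e e1; first by rewrite m1 e1L.
  have [->|n2] := eqVneq e e2; first by rewrite (negbTE e2R) andbF.
  by apply/negP => /andP[/str/(_ n1 n2)[/negP]].
- apply/eqP/setP => e; rewrite !inE; have [->|n2] := eqVneq e e2; first by rewrite m2 e2L.
  have [->|n1] := eqVneq e e1; first by rewrite (negbTE e1R) andbF.
  by apply/negP => /andP[/str/(_ n1 n2)[_ /negP]].
Qed.

(** * Edge counts inside, across and outside a set *)

Lemma card_inside_setU1 M A x : trivIset M ->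
  #|inside M (x |: A)| <= (#|inside M A|).+1.
Proof.
(* Only a block containing [x] can be newly enclosed, and disjointness leaves at most one. *)
move=> tM; apply: (@leq_trans #|pblock M x |: inside M A|); last first.
  by rewrite cardsU1 -add1n leq_add2r leq_b1.
apply/subset_leq_card/subsetP => e; rewrite !inE => /andP[eM eA].
rewrite eM /=; have [xe|xe] := boolP (x \in e).
  by rewrite (def_pblock tM eM xe) eqxx.
apply/orP; right; apply/subsetP => z ze.
have := subsetP eA z ze; rewrite !inE; case: eqP => // zx.
by rewrite -zx ze in xe.
Qed.

Lemma card_setT_inside_cut M A : partition M setT ->
  #|M| = #|inside M A| + #|cut M A| + #|inside M (~: A)|.
Proof.
move=> pM; rewrite -!sum1_card.
rewrite !(eq_bigl _ _ (in_set _)) !big_mkcondr /= -!big_split /=.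
apply: eq_bigr => e eM; have := @subset_setCF e A (partition_neq0 pM eM).
by case: (e \subset A) => [/(_ isT)/negbTE->|_] //; case: (e \subset ~: A).
Qed.

(** The points of [A] are counted edge by edge: an edge inside [A] holds two of them, a cut edge
    one, any other edge none. *)
Lemma card_inside_cut M A :
  partition M setT -> {in M, forall e : {set T}, #|e| = 2} ->
  #|A| = (#|inside M A|).*2 + #|cut M A|.
Proof.
move=> pM M2; have -> : #|A| = \sum_(e in M) #|e :&: A|.
  transitivity (\sum_(x in setT | x \in A) 1).
    by rewrite sum1dep_card; apply: eq_card => x; rewrite !inE.
  rewrite (@set_partition_big_cond _ _ _ _ M) //; apply: eq_bigr => e _.
  by rewrite sum1dep_card; apply: eq_card => x; rewrite !inE.
rewrite -addnn -!sum1_card.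
rewrite !(eq_bigl _ _ (in_set _)) !big_mkcondr /= -!big_split /=.
apply: eq_bigr => e eM.
have := straddlesE A (M2 e eM); have := cardsID A e; rewrite (M2 e eM) /straddles.
rewrite -disjoints_subset -setI_eq0 -setD_eq0 -!cards_eq0.
by case: #|e :&: A| => [|[|[|?]]]; case: #|e :\: A| => [|[|[|?]]].
Qed.

Lemma card_matching M :
  partition M setT -> {in M, forall e : {set T}, #|e| = 2} -> #|T| = #|M|.*2.
Proof.
move=> pM M2; rewrite -cardsT (card_inside_cut setT pM M2).
have -> : inside M setT = M by apply/setP => e; rewrite inE subsetT andbT.
have -> : cut M setT = set0 by apply/setP => e; rewrite !inE subsetT andbF.
by rewrite cards0 addn0.
Qed.

(** Used to turn the edge counts for the segments ending at [n - 1] and [n + 1] into conditions on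
    the two inner edges alone. *)
Lemma in_inside_set1 M A B e : B \subset A ->
  inside M A = [set e] -> (#|inside M B| == 0) = ~~ (e \subset B).
Proof.
move=> BA iA; rewrite cards_eq0.
have [eM eA] : e \in M /\ e \subset A by apply/andP; have := set11 e; rewrite -iA inE.
apply/eqP/idP => [iB|eB].
  by apply/negP => eB; have := in_set0 e; rewrite -iB inE eM eB.
apply/setP => f; rewrite !inE; apply/negP => /andP[fM fB].
have : f \in inside M A by rewrite inE fM (subset_trans fB).
by rewrite iA inE => /eqP fe; rewrite -fe fB in eB.
Qed.

End Blocks.

(** * Initial segments and the sock number *)

Lemma card_initial N k : k <= N -> #|initial N k| = k.
Proof.
move=> kN; have inj : injective (widen_ord kN).
  by move=> i j [ij]; apply: val_inj.
rewrite -[RHS]card_ord -(card_imset predT inj); apply: eq_card => i.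
rewrite inE; apply/idP/imsetP => [ik|[j _ ->]] /=; last exact: ltn_ord.
by exists (Ordinal ik) => //; apply: val_inj.
Qed.

Lemma initialS N k (kN : k < N) :
  initial N k.+1 = Ordinal kN |: initial N k.
Proof. by apply/setP => i; rewrite !inE ltnS leq_eqVlt. Qed.

Lemma crossingE n (M : {set {set 'I_(2 * n)}}) k :
  crossing M k = #|cut M (initial (2 * n) k)|.
Proof.
apply: eq_card => e; rewrite !inE; congr (_ && _).
apply/exists_inP/andP => [[i ie /exists_inP[j je]]|[/subsetPn[j je jA] /subsetPn[i ie iA]]].
  rewrite in_setC => /andP[iA jA]; split; apply/subsetPn; [by exists j | exists i] => //.
  by rewrite in_setC negbK.
exists i => //; apply/exists_inP; exists j => //.
by rewrite in_setC jA andbT -[_ \in _]negbK -in_setC.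
Qed.

Lemma sock_number_eq n (M : {set {set 'I_(2 * n)}}) : 0 < n ->
  partition M setT -> {in M, forall e : {set 'I_(2 * n)}, #|e| = 2} ->
  (sock_number M == n - 1) =
  [&& #|inside M (initial (2 * n) n)| == 1,
      #|inside M (~: initial (2 * n) n)| == 1 &
      (#|inside M (initial (2 * n) n.-1)| == 0) ||
      (#|inside M (~: initial (2 * n) n.+1)| == 0)].
Proof.
move=> n0 pM M2.
have cM : #|M| = n.
  by have := card_matching pM M2; rewrite card_ord; lia.
pose i k := #|inside M (initial (2 * n) k)|.
pose o k := #|inside M (~: initial (2 * n) k)|.
have E1 k : k <= 2 * n -> k = (i k).*2 + crossing M k.
  by move=> kn; rewrite crossingE -card_inside_cut // card_initial.
have E2 k : n = i k + crossing M k + o k.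
  by rewrite crossingE -card_setT_inside_cut.
have tM := partition_trivIset pM.
have iS k : k < 2 * n -> i k.+1 <= (i k).+1.
  by move=> kn; rewrite /i (initialS kn) card_inside_setU1.
have oS k : k < 2 * n -> o k <= (o k.+1).+1.
  move=> kn; rewrite /o.
  have -> : ~: initial (2 * n) k = Ordinal kn |: ~: initial (2 * n) k.+1.
    apply/setP => j; rewrite !inE -!leqNgt leq_eqVlt; congr (_ || _).
    by rewrite eq_sym.
  exact: card_inside_setU1.
rewrite -/(i n) -/(o n) -/(i n.-1) -/(o n.+1).
have le_sock k : 0 < k <= 2 * n -> crossing M k <= sock_number M.
  move=> /andP[k0 kn]; rewrite /sock_number.
  by apply: (@leq_bigmax_seq _ _ xpredT (crossing M)); rewrite // mem_index_iota k0 ltnS.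
have [k kn sE] : exists2 k, 0 < k <= 2 * n & sock_number M = crossing M k.
  rewrite /sock_number big_add1 big_mkord.
  have [|k ->] := @eq_bigmax 'I_(2 * n) (fun k => crossing M k.+1).
    by rewrite card_ord muln_gt0.
  by exists k.+1; rewrite ?ltn_ord.
(* From here on only arithmetic remains: the two identities and the bounds are instantiated at
   [n - 1], [n], [n + 1] and at a maximizer [k]. *)
clearbody i o; clear M2 cM tM pM.
have oSn := oS n.
have iSn : i n <= (i n.-1).+1 by rewrite -{1}(prednK n0); apply: iS; lia.
have [[l0 l1] l2] := (le_sock n, le_sock n.-1, le_sock n.+1).
have [[a0 a1] [a2 a3]] := ((E1 n.-1, E1 n), (E1 n.+1, E1 k)).
have [[b0 b1] [b2 b3]] := ((E2 n.-1, E2 n), (E2 n.+1, E2 k)).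
apply/idP/idP => [/eqP sn|/and3P[/eqP in1 /eqP on1 /orP io]].
  (* Here [crossing M k = n - 1] means [i k + o k = 1]. Moreover [i n = o n], and this value is not
     0, as otherwise [n] edges would cross at [n]. *)
  have [ik|ok] : i k = 0 \/ o k = 0 by lia.
    have kE : k = n.-1 by lia.
    by subst k; apply/and3P; split; lia.
  have kE : k = n.+1 by lia.
  by subst k; apply/and3P; split; lia.
(* The crossing number is [n - 2] at [n], the only place where it could be [n], and reaches [n - 1]
   at [n - 1] or [n + 1] by [io]. *)
have kn' : k <> n by move=> kE; subst k; lia.
by case: io => /eqP io; lia.
Qed.

(** * Counting matchings by their pair of inner edges *)

Theorem proposition3p2 (n : nat) (hn : 1 <= n) :
  sock_count (n - 1) n = (n - 1) ^ 2 * (n - 1)`!.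
Proof.
rewrite /sock_count.
set S := [set M | _ & _].
pose I k := initial (2 * n) k.
pose E (A : {set 'I_(2 * n)}) := [set e : {set _} | e \subset A & #|e| == 2].
(* The removed pairs are those where [e1] misses the point [n] and [e2] misses [n + 1]. *)
pose P := setX (E (I n)) (E (~: I n)) :\: setX (E (I n.-1)) (E (~: I n.+1)).
have I0 : I n.-1 \subset I n by apply/subsetP => i; rewrite !inE; lia.
have I1 : ~: I n.+1 \subset ~: I n.
  by rewrite setCS; apply/subsetP => i; rewrite !inE; lia.
have SE M : M \in S = [&& partition M setT, [forall e in M, #|e| == 2],
      #|inside M (I n)| == 1, #|inside M (~: I n)| == 1 &
      (#|inside M (I n.-1)| == 0) || (#|inside M (~: I n.+1)| == 0)].
  rewrite inE /is_matching.
  case: (boolP (partition _ _)) => [pM|] //=.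
  case: (boolP [forall e in M, _]) => [/forall_inP M2|]; last by rewrite andbF.
  have {}M2 : {in M, forall e : {set 'I_(2 * n)}, #|e| = 2} by move=> e /M2/eqP.
  rewrite (sock_number_eq hn pM M2) andbT.
  suff -> : #|M| == n by [].
  by have := card_matching pM M2; rewrite card_ord; lia.
have cI k : k <= 2 * n -> #|~: I k| = 2 * n - k.
  by move=> kn; rewrite cardsCs setCK card_initial // card_ord.
have cP : #|P| * (n - 2)`! = (n - 1) ^ 2 * (n - 1)`!.
  have cE A : #|E A| = 'C(#|A|, 2) by exact: cards_draws.
  rewrite cardsDS; last by apply: setXS; apply/subsetP => e; rewrite !inE => /andP[eA ->];
    rewrite andbT; exact: subset_trans eA _.
  rewrite !cardsX !cE !cI ?card_initial; try lia.
  have [-> ->] : 2 * n - n = n /\ 2 * n - n.+1 = n.-1 by lia.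
  (* For [n <= 1] both sides vanish. Otherwise, with [c = 'C(n - 1, 2)], Pascal's rule gives
     ['C(n, 2) = c + (n - 1)], and [2 * c = (n - 1) * (n - 2)] because a product of consecutive
     integers is even; so the difference of squares is [(n - 1) ^ 3]. *)
  clear; case: n => [|[|p]] //; rewrite !subSS !subn0 /= binS bin1 factS.
  have := bin2 p.+1; have := odd_double_half (p.+1 * p); rewrite oddM /= andNb.
  by move: 'C(_, _) => c; move: (p`!) => f; nia.
rewrite -cP.
apply: (card_fibers (r := fun M e => (inside M (I n) == [set e.1]) &&
                                  (inside M (~: I n) == [set e.2]))).
- move=> M; rewrite SE => /and5P[pM M2 /cards1P[e1 i1] /cards1P[e2 i2]].
  rewrite (in_inside_set1 I0 i1) (in_inside_set1 I1 i2) => e12.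
  apply/eqP/cards1P; exists (e1, e2); apply/setP => -[f1 f2].
  rewrite !inE /= i1 i2 !(inj_eq set1_inj) [e1 == _]eq_sym [e2 == _]eq_sym xpair_eqE.
  case: (f1 =P e1) => [->|]; last by rewrite !andbF.
  case: (f2 =P e2) => [->|]; last by rewrite !andbF.
  have [e1M e1I] : e1 \in M /\ e1 \subset I n.
    by apply/andP; have := set11 e1; rewrite -i1 inE.
  have [e2M e2I] : e2 \in M /\ e2 \subset ~: I n.
    by apply/andP; have := set11 e2; rewrite -i2 inE.
  move/forall_inP: M2 => M2.
  by rewrite e1I e2I !M2 // !andbT negb_and e12.
move=> [e1 e2]; rewrite !inE /= => /andP[e12 /andP[/andP[e1I c1] /andP[e2I c2]]].
(* The two points of [e1] fit in [I n], so the truncated difference [n - 2] is exact whenever [P]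
   has an element. *)
have n2 : 1 < n.
  by have := subset_leq_card e1I; rewrite (eqP c1) card_initial; lia.
rewrite -(@card_matchings_inside _ (I n) e1 e2) ?(eqP c1) ?(eqP c2) //.
- apply: eq_card => M; rewrite inE SE [in RHS]inE.
  apply/andP/and4P => [[/and5P[-> -> _ _ _] /andP[-> ->]] //|[pM M2 /eqP i1 /eqP i2]].
  rewrite pM M2 i1 i2 !cards1 !eqxx; split=> //=.
  rewrite (in_inside_set1 I0 i1) (in_inside_set1 I1 i2).
  by rewrite -negb_and; move: e12; rewrite c1 c2 !andbT.
- by rewrite card_initial; lia.
- by rewrite cI; lia.
Qed.
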